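(* Let $H$ be a Hilbert module over a $C^*$-algebra, and let $P_1,P_2\in\mathcal{L}(H)$ be projections such that $\|P_1P_2\|<1$. Then $$\|m(Q_1)-m(Q_2)\|\le \|Q_1-Q_2\|,$$ where $Q_1$ and $Q_2$ are the idempotents defined by $$Q_1=(I-P_1P_2)^{-1}P_1(I-P_2),\quad Q_2=(I-P_2P_1)^{-1}P_2(I-P_1),$$ and $m(Q_1)$, $m(Q_2)$ are their matched projections.
   Context: $\mathcal{L}(H)$ is the $C^*$-algebra of adjointable operators on the Hilbert $C^*$-module $H$, and $I$ is the identity operator on $H$. $\mathcal{R}(\cdot)$ and $\mathcal{N}(\cdot)$ denote range and null space. An idempotent is $Q\in\mathcal{L}(H)$ with $Q^2=Q$; a projection is a self-adjoint idempotent. $P_{\mathcal{R}(Q)}$ is the projection of $H$ onto the (orthogonally complemented) range of $Q$. Definition of the matched projection $m(Q)$ of an idempotent $Q\in\mathcal{L}(H)$: if $Q$ is a projection, $m(Q)=Q$. Otherwise, $H=\mathcal{R}(Q)\dotplus\mathcal{N}(Q^* )$ is an orthogonal decomposition; let $U:H\to\mathcal{R}(Q)\oplus\mathcal{N}(Q^* )$ be the unitary $Uh=\binom{P_{\mathcal{R}(Q)}h}{(I-P_{\mathcal{R}(Q)})h}$, let $I_1$ be the identity on $\mathcal{R}(Q)$, let $A=(Q-P_{\mathcal{R}(Q)})|_{\mathcal{N}(Q^* )}:\mathcal{N}(Q^* )\to\mathcal{R}(Q)$ and $B=(AA^*+I_1)^{1/2}$, and set $$m(Q)=U^*\cdot\frac12\begin{pmatrix}(B+I_1)B^{-1}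 & B^{-1}A\\ A^*B^{-1} & A^*[B(B+I_1)]^{-1}A\end{pmatrix}\cdot U .$$ *)

(* Defs.v *)
From HB Require Import structures.
From mathcomp Require Import all_boot all_order all_algebra.
From mathcomp Require Import complex.
From mathcomp Require Import all_classical all_reals all_analysis.
Set Implicit Arguments.
Unset Strict Implicit.
Unset Printing Implicit Defensive.
Import Order.TTheory GRing.Theory Num.Theory.
Import numFieldNormedType.Exports.
Local Open Scope classical_set_scope.
Local Open Scope ring_scope.
Local Open Scope complex_scope.

(* C*-algebras over the complex numbers R[i]; no unit is required, hence the
   product is not that of a MathComp ring. *)
HB.mixin Record isCstarAlgebra (R : realType) A
    of CompleteNormedModule R[i] A := {
  cmul : A -> A -> A;
  cstar : A -> A;
  cmulA : associative cmul;
  cmulDl : left_distributive cmul +%R;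
  cmulDr : right_distributive cmul +%R;
  cmulZl : forall (k : R[i]) (a b : A), cmul (k *: a) b = k *: cmul a b;
  cmulZr : forall (k : R[i]) (a b : A), cmul a (k *: b) = k *: cmul a b;
  cstarK : involutive cstar;
  cstarD : forall a b : A, cstar (a + b) = cstar a + cstar b;
  cstarZ : forall (k : R[i]) (a : A), cstar (k *: a) = k^* *: cstar a;
  cstarM : forall a b : A, cstar (cmul a b) = cmul (cstar b) (cstar a);
  cnormM : forall a b : A, `|cmul a b| <= `|a| * `|b|;
  cnorm_star : forall a : A, `|cmul (cstar a) a| = `|a| ^+ 2 }.

#[short(type="cstarAlgType")]
HB.structure Definition CstarAlgebra (R : realType) :=
  {A of isCstarAlgebra R A & CompleteNormedModule R[i] A}.

Definition cstar_pos (R : realType) (A : cstarAlgType R) (a : A) :=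
  exists b : A, a = cmul (cstar b) b.

(* Right inner-product A-modules, with inner product linear in the second
   variable; completeness is only added in [hilbertModType]. *)
HB.mixin Record isInnerModule (R : realType) (A : cstarAlgType R) H
    of GRing.Lmodule R[i] H := {
  act : H -> A -> H;
  inner : H -> H -> A;
  actM : forall (x : H) (a b : A), act x (cmul a b) = act (act x a) b;
  actDl : forall (x y : H) (a : A), act (x + y) a = act x a + act y a;
  actDr : forall (x : H) (a b : A), act x (a + b) = act x a + act x b;
  actZl : forall (k : R[i]) (x : H) (a : A), act (k *: x) a = k *: act x a;
  actZr : forall (k : R[i]) (x : H) (a : A), act x (k *: a) = k *: act x a;
  innerDr : forall x y z : H, inner x (y + z) = inner x y + inner x z;
  innerZr : forall (k : R[i]) (x y : H), inner x (k *: y) = k *: inner x y;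
  inner_act : forall (x y : H) (a : A), inner x (act y a) = cmul (inner x y) a;
  inner_star : forall x y : H, cstar (inner x y) = inner y x;
  inner_pos : forall x : H, cstar_pos (inner x x);
  inner_eq0 : forall x : H, inner x x = 0 -> x = 0 }.

#[short(type="innerModType")]
HB.structure Definition InnerModule (R : realType) (A : cstarAlgType R) :=
  {H of isInnerModule R A H & GRing.Lmodule R[i] H}.

HB.mixin Record isHilbertModule (R : realType) (A : cstarAlgType R) H
    of CompleteNormedModule R[i] H & InnerModule R A H := {
  hnormE : forall x : H, `|x| ^+ 2 = `|inner x x : A| }.

#[short(type="hilbertModType")]
HB.structure Definition HilbertModule (R : realType) (A : cstarAlgType R) :=
  {H of isHilbertModule R A H & CompleteNormedModule R[i] H
      & InnerModule R A H}.

Section InnerModuleTheory.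
Context (R : realType) (A : cstarAlgType R).

Lemma inner_right_inj (H : innerModType A) (x y : H) :
  (forall z, inner z x = inner z y) -> x = y.
Proof.
move=> xy; apply/eqP; rewrite -subr_eq0; apply/eqP/inner_eq0.
set z := x - y; rewrite {2}/z -[- y]scaleN1r innerDr innerZr xy.
by rewrite scaleN1r subrr.
Qed.

Lemma innerDl (H : innerModType A) (x y z : H) :
  inner (x + y) z = inner x z + inner y z.
Proof. by rewrite -inner_star innerDr cstarD !inner_star. Qed.

Lemma innerZl (H : innerModType A) (k : R[i]) (x y : H) :
  inner (k *: x) y = k^* *: inner x y.
Proof. by rewrite -inner_star innerZr cstarZ inner_star. Qed.

Lemma inner0l (H : innerModType A) (x : H) : inner 0 x = 0.
Proof. by rewrite -(scale0r (0 : H)) innerZl rmorph0 scale0r. Qed.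

Lemma inner0r (H : innerModType A) (x : H) : inner x 0 = 0.
Proof. by rewrite -(scale0r (0 : H)) innerZr scale0r. Qed.

End InnerModuleTheory.

Section Adjointable.
Context (R : realType) (A : cstarAlgType R).
Implicit Types H K : innerModType A.

Definition is_adjoint H K (f : H -> K) (g : K -> H) :=
  forall x y, inner (f x) y = inner x (g y).

Definition adjointable H K : {pred H -> K} :=
  fun f => `[< exists g, is_adjoint f g >].
Arguments adjointable : clear implicits.

Lemma adjointable_submod H K : submod_closed (adjointable H K).
Proof.
split; first by apply/asboolP; exists 0 => x y /=; rewrite inner0l inner0r.
move=> k f g /asboolP[f' ff'] /asboolP[g' gg']; apply/asboolP.
exists (fun y => k^* *: f' y + g' y) => x y /=.
by rewrite innerDl innerZl innerDr innerZr ff' gg'.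
Qed.

HB.instance Definition _ H K :=
  GRing.isSubmodClosed.Build R[i] (H -> K) (adjointable H K)
    (@adjointable_submod H K).

(* L(H, K); linearity over R[i] and over A is a consequence. *)
Record adjop H K := AdjOp {
  adjop_fun :> H -> K;
  _ : adjop_fun \in adjointable H K }.

HB.instance Definition _ H K := [isSub of adjop H K for @adjop_fun H K].
HB.instance Definition _ H K := [Choice of adjop H K by <:].
HB.instance Definition _ H K := [SubChoice_isSubLmodule of adjop H K by <:].

Lemma adjopP H K (S T : adjop H K) : S =1 T -> S = T.
Proof. by move=> ST; apply/val_inj/funext. Qed.

Lemma adj_exists H K (T : adjop H K) :
  exists S : adjop K H, is_adjoint T S.
Proof.
have /asboolP[g Tg] := valP T.
suff gP : g \in adjointable K H by exists (AdjOp gP).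
apply/asboolP; exists T => y x.
by rewrite -inner_star -Tg inner_star.
Qed.

Definition adj H K (T : adjop H K) : adjop K H := projT1 (cid (adj_exists T)).

Lemma adjE H K (T : adjop H K) x y : inner (T x) y = inner x (adj T y).
Proof. exact: (projT2 (cid (adj_exists T))). Qed.

Lemma adjop_linear H K (T : adjop H K) : linear T.
Proof.
move=> k x y; apply: inner_right_inj => z.
rewrite -inner_star adjE innerDl innerZl -!adjE cstarD cstarZ conjCK !inner_star.
by rewrite innerDr innerZr.
Qed.
HB.instance Definition _ H K (T : adjop H K) :=
  GRing.isLinear.Build R[i] H K _ T (adjop_linear T).

Lemma adjop_act H K (T : adjop H K) x (a : A) : T (act x a) = act (T x) a.
Proof.
apply: inner_right_inj => z; rewrite inner_act -[inner z (T x)]inner_star adjE.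
rewrite -[LHS]inner_star adjE !inner_star inner_act.
by [].
Qed.

Lemma adjop_id_subproof H : (id : H -> H) \in adjointable H H.
Proof. by apply/asboolP; exists id. Qed.
Definition adjop_id H : adjop H H := AdjOp (@adjop_id_subproof H).

Lemma adjop_comp_subproof H K L (S : adjop K L) (T : adjop H K) :
  S \o T \in adjointable H L.
Proof.
by apply/asboolP; exists (adj T \o adj S) => x y /=; rewrite !adjE.
Qed.
Definition adjop_comp H K L (S : adjop K L) (T : adjop H K) : adjop H L :=
  AdjOp (adjop_comp_subproof S T).

Lemma adjop_compA H : associative (@adjop_comp H H H).
Proof. by move=> S T U; apply: adjopP. Qed.
Lemma adjop_comp1o H : left_id (adjop_id H) (@adjop_comp H H H).
Proof. by move=> S; apply: adjopP. Qed.
Lemma adjop_compo1 H : right_id (adjop_id H) (@adjop_comp H H H).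
Proof. by move=> S; apply: adjopP. Qed.
Lemma adjop_compDl H : left_distributive (@adjop_comp H H H) +%R.
Proof. by move=> S T U; apply: adjopP. Qed.
Lemma adjop_compDr H : right_distributive (@adjop_comp H H H) +%R.
Proof. by move=> S T U; apply: adjopP => x /=; rewrite raddfD. Qed.

HB.instance Definition _ H := GRing.Zmodule_isPzRing.Build (adjop H H)
  (@adjop_compA H) (@adjop_comp1o H) (@adjop_compo1 H)
  (@adjop_compDl H) (@adjop_compDr H).

End Adjointable.

Notation "T ^*o" := (adj T) (at level 1, format "T ^*o") : ring_scope.
Notation "S \c T" := (adjop_comp S T) (at level 40, left associativity)
  : ring_scope.

Section Submodules.
Context (R : realType) (A : cstarAlgType R).
Implicit Types H K : innerModType A.

Record submodule H := Submodule {
  submod_pred :> {pred H};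
  submodP : submod_closed submod_pred;
  submod_act : forall x (a : A), x \in submod_pred -> act x a \in submod_pred }.

HB.instance Definition _ H (M : submodule H) :=
  GRing.isSubmodClosed.Build R[i] H (submod_pred M) (submodP M).

Record submod_type H (M : submodule H) := SubmodElt {
  submod_val : H;
  _ : submod_val \in submod_pred M }.

HB.instance Definition _ H (M : submodule H) :=
  [isSub for @submod_val H M].
HB.instance Definition _ H (M : submodule H) :=
  [Choice of submod_type M by <:].
HB.instance Definition _ H (M : submodule H) :=
  [SubChoice_isSubLmodule of submod_type M by <:].

Section SubInner.
Context (H : innerModType A) (M : submodule H).
Let T := submod_type M.

Definition sub_act (x : T) (a : A) : T :=
  SubmodElt (submod_act a (valP x)).
Definition sub_inner (x y : T) : A := inner (val x) (val y).

Fact sub_actM (x : T) a b : sub_act x (cmul a b) = sub_act (sub_act x a) b.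
Proof. exact/val_inj/actM. Qed.
Fact sub_actDl (x y : T) a : sub_act (x + y) a = sub_act x a + sub_act y a.
Proof. exact/val_inj/actDl. Qed.
Fact sub_actDr (x : T) a b : sub_act x (a + b) = sub_act x a + sub_act x b.
Proof. exact/val_inj/actDr. Qed.
Fact sub_actZl k (x : T) a : sub_act (k *: x) a = k *: sub_act x a.
Proof. exact/val_inj/actZl. Qed.
Fact sub_actZr k (x : T) a : sub_act x (k *: a) = k *: sub_act x a.
Proof. exact/val_inj/actZr. Qed.
Fact sub_innerDr (x y z : T) :
  sub_inner x (y + z) = sub_inner x y + sub_inner x z.
Proof. exact: innerDr. Qed.
Fact sub_innerZr k (x y : T) : sub_inner x (k *: y) = k *: sub_inner x y.
Proof. exact: innerZr. Qed.
Fact sub_inner_act (x y : T) a :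
  sub_inner x (sub_act y a) = cmul (sub_inner x y) a.
Proof. exact: inner_act. Qed.
Fact sub_inner_star (x y : T) : cstar (sub_inner x y) = sub_inner y x.
Proof. exact: inner_star. Qed.
Fact sub_inner_pos (x : T) : cstar_pos (sub_inner x x).
Proof. exact: inner_pos. Qed.
Fact sub_inner_eq0 (x : T) : sub_inner x x = 0 -> x = 0.
Proof. by move=> x0; apply/val_inj/inner_eq0. Qed.

HB.instance Definition _ := isInnerModule.Build R A (submod_type M)
  sub_actM sub_actDl sub_actDr sub_actZl sub_actZr sub_innerDr sub_innerZr
  sub_inner_act sub_inner_star sub_inner_pos sub_inner_eq0.
End SubInner.

Definition range_pred H K (T : adjop H K) : {pred K} :=
  fun y => `[< exists x, T x = y >].
Fact range_submod H K (T : adjop H K) : submod_closed (range_pred T).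
Proof.
split; first by apply/asboolP; exists 0; rewrite raddf0.
move=> k _ _ /asboolP[x <-] /asboolP[y <-]; apply/asboolP.
by exists (k *: x + y); rewrite linearP.
Qed.
Fact range_act H K (T : adjop H K) x (a : A) :
  x \in range_pred T -> act x a \in range_pred T.
Proof.
move=> /asboolP[y <-]; apply/asboolP.
by exists (act y a); rewrite adjop_act.
Qed.
Definition op_range H K (T : adjop H K) : submodule K :=
  Submodule (range_submod T) (@range_act H K T).

Definition null_pred H K (T : adjop H K) : {pred H} := fun x => `[< T x = 0 >].
Fact null_submod H K (T : adjop H K) : submod_closed (null_pred T).
Proof.
split; first by apply/asboolP; rewrite raddf0.
move=> k x y /asboolP x0 /asboolP y0; apply/asboolP.
by rewrite linearP /= x0 y0 scaler0 addr0.
Qed.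
Fact null_act H K (T : adjop H K) x (a : A) :
  x \in null_pred T -> act x a \in null_pred T.
Proof.
move=> /asboolP x0; apply/asboolP; rewrite adjop_act x0.
by rewrite -(scale0r 0) actZl !scale0r.
Qed.
Definition op_null H K (T : adjop H K) : submodule H :=
  Submodule (null_submod T) (@null_act H K T).

End Submodules.

Section MatchedProjection.
Context (R : realType) (A : cstarAlgType R).
Implicit Types H K : innerModType A.

Definition is_idempotent H (Q : adjop H H) := Q * Q = Q.

Definition is_projection H (P : adjop H H) := is_idempotent P /\ P^*o = P.

(* Inverse, positive square root and range projection are unique when they
   exist; they are made total with default value 0. *)
Definition op_inv H (T : adjop H H) : adjop H H :=
  xget 0 [set S | S * T = 1 /\ T * S = 1].

Definition op_pos H (T : adjop H H) := exists S : adjop H H, T = S^*o * S.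

Definition op_sqrt H (T : adjop H H) : adjop H H :=
  xget 0 [set B | op_pos B /\ B * B = T].

Definition range_proj H (Q : adjop H H) : adjop H H :=
  xget 0 [set P | is_projection P /\ op_range P =i op_range Q].

(* The map f, known to take its values in M, as an element of L(K, M). *)
Definition corestrict H K (M : submodule H) (f : K -> H) :
    adjop K (submod_type M) :=
  xget (0 : adjop K (submod_type M)) [set T | forall x, val (T x) = f x].

Section Blocks.
Context (H : innerModType A) (Q : adjop H H).
Let P := range_proj Q.
Let RQ : innerModType A := submod_type (op_range Q).
Let NQ : innerModType A := submod_type (op_null Q^*o).

(* The components of the unitary U : H -> R(Q) (+) N(Q^* ), so that
   U h = (P h, (1 - P) h). *)
Definition matched_U1 : adjop H RQ := corestrict (op_range Q) P.
Definition matched_U2 : adjop H NQ :=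
  corestrict (op_null Q^*o) (1 - P : adjop H H).

Definition matched_A : adjop NQ RQ :=
  corestrict (op_range Q) (fun x : NQ => (Q - P) (val x)).

Definition matched_B : adjop RQ RQ :=
  op_sqrt (matched_A \c matched_A^*o + 1).

(* U^* M U for the 2 x 2 operator matrix M = (M11, M12; M21, M22) *)
Definition block_conj (M11 : adjop RQ RQ) (M12 : adjop NQ RQ)
    (M21 : adjop RQ NQ) (M22 : adjop NQ NQ) : adjop H H :=
  matched_U1^*o \c (M11 \c matched_U1 + M12 \c matched_U2)
  + matched_U2^*o \c (M21 \c matched_U1 + M22 \c matched_U2).

(* Only meaningful for an idempotent Q: otherwise P, A need not exist. *)
Definition matched : adjop H H :=
  let A0 := matched_A in let B := matched_B in
  if `[< is_projection Q >] then Q else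
  2^-1 *: block_conj ((B + 1) * op_inv B) (op_inv B \c A0)
    (A0^*o \c op_inv B) (A0^*o \c op_inv (B * (B + 1)) \c A0).
End Blocks.
End MatchedProjection.

(* Adjointable operators between Hilbert modules are bounded, so the supremum
   is that of a bounded set. *)
Definition opnorm (R : realType) (A : cstarAlgType R) (H : hilbertModType A)
    (T : adjop H H) : R :=
  sup [set complex.Re `|T x| | x in [set x : H | `|x| <= 1]].

(* Main.v *)
Require Import Defs.
From HB Require Import structures.
From mathcomp Require Import all_boot all_order all_algebra.
From mathcomp Require Import complex.
From mathcomp Require Import all_classical all_reals all_analysis.
From mathcomp Require Import ring lra.
Set Implicit Arguments.
Unset Strict Implicit.
Unset Printing Implicit Defensive.
Import Order.TTheory GRing.Theory Num.Theory.
Import numFieldNormedType.Exports.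
Local Open Scope ring_scope.

(* Both matched projections are genuine projections, so 2 (m(Q1) - m(Q2)) is
   a difference of two unitaries and ||m(Q1) - m(Q2)|| <= 1.  On the other
   hand Q1 Q2 = Q2 Q1 = 0, hence F = Q1 - Q2 satisfies F^2 = Q1 + Q2, an
   idempotent: if ||F|| < 1 then Q1 + Q2 = 0, hence Q1 = Q2 = 0, and
   otherwise ||F|| >= 1.

   For m(Q) to be a projection, B + 1 has to be invertible.  Writing B = S^* S
   and C = B^-1, the point is that -1 is not in the spectrum of C, which is
   obtained as in the Kelley-Vaught theorem (x^* x is positive), but without
   functional calculus: polynomials in the contraction C and
   W W^* + W^* W = (G^2 + K^2) / 2, with W = (G - i K) / 2 and G, K
   self-adjoint, suffice. *)

(** * Real-valued norms over complex scalars *)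

Section RealNorm.
Local Open Scope complex_scope.
Context (R : realType).

(** Norms over [R[i]] take values in [R[i]]; their real parts lie in [R], where [lra] and [nra]
    apply. *)
Definition rnorm (V : normedModType R[i]) (x : V) : R := complex.Re `|x|.

Context (V : normedModType R[i]).
Implicit Types x y : V.

Lemma rnormE x : (rnorm x)%:C = `|x|.
Proof. exact: RRe_real (normr_real x). Qed.

Lemma rnorm_ge0 x : 0 <= rnorm x.
Proof. by rewrite -ler0c rnormE. Qed.

Lemma rnorm0 : rnorm (0 : V) = 0.
Proof. by rewrite /rnorm normr0. Qed.

Lemma rnorm0_eq0 x : rnorm x = 0 -> x = 0.
Proof. by move=> x0; apply: normr0_eq0; rewrite -rnormE x0. Qed.

Lemma rnormD x y : rnorm (x + y) <= rnorm x + rnorm y.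
Proof. by rewrite -lecR rmorphD /= !rnormE ler_normD. Qed.

Lemma rnormN x : rnorm (- x) = rnorm x.
Proof. by rewrite /rnorm normrN. Qed.

Lemma rnormB x y : rnorm (x - y) <= rnorm x + rnorm y.
Proof. by rewrite -[rnorm y]rnormN rnormD. Qed.

Lemma rnormC x y : rnorm (x - y) = rnorm (y - x).
Proof. by rewrite -rnormN opprB. Qed.

Lemma normc_real (r : R) : `|r%:C| = `|r|%:C.
Proof. by rewrite normc_def /= expr0n /= addr0 sqrtr_sqr. Qed.

Lemma normc_imag (r : R) : `|0 +i* r| = `|r|%:C.
Proof. by rewrite normc_def /= expr0n /= add0r sqrtr_sqr. Qed.

Lemma conjC_real (r : R) : (r%:C)^*%R = r%:C.
Proof. exact: conjc_real. Qed.

Lemma conjC_imag (r : R) : (0 +i* r)^*%R = 0 +i* (- r).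
Proof. by []. Qed.

Lemma rnormZ (r : R) x : rnorm (r%:C *: x) = `|r| * rnorm x.
Proof. by apply: complexI; rewrite rmorphM /= !rnormE normrZ normc_real. Qed.

Lemma rnormiZ (r : R) x : rnorm ((0 +i* r) *: x) = `|r| * rnorm x.
Proof. by apply: complexI; rewrite rmorphM /= !rnormE normrZ normc_imag. Qed.

Lemma rnormZ_ge0 (r : R) x : 0 <= r -> rnorm (r%:C *: x) = r * rnorm x.
Proof. by move=> r0; rewrite rnormZ ger0_norm. Qed.

End RealNorm.

(** * Algebra of adjoints and inverses *)

Section AdjointTheory.
Context (R : realType) (A : cstarAlgType R).
Implicit Types H K L : innerModType A.

Lemma is_adjoint_eq H K (T : adjop H K) (S : adjop K H) :
  is_adjoint T S -> T^*o = S.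
Proof.
move=> TS; apply: adjopP => y; apply: inner_right_inj => x.
by rewrite -adjE TS.
Qed.

Lemma adj_inner H K (T : adjop H K) x y : inner (T^*o y) x = inner y (T x).
Proof. by rewrite -inner_star -adjE inner_star. Qed.

Lemma adjopK H K (T : adjop H K) : T^*o^*o = T.
Proof. by apply: is_adjoint_eq => x y; rewrite adj_inner. Qed.

Lemma adjop0 H K : (0 : adjop H K)^*o = 0.
Proof. by apply: is_adjoint_eq => x y /=; rewrite inner0l inner0r. Qed.

Lemma adjopD H K (S T : adjop H K) : (S + T)^*o = S^*o + T^*o.
Proof. by apply: is_adjoint_eq => x y; rewrite innerDl innerDr !adjE. Qed.

Lemma adjopZ H K (k : R[i]) (T : adjop H K) :
  (k *: T)^*o = k^* *: T^*o.
Proof.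
by apply: is_adjoint_eq => x y; rewrite [LHS]innerZl [RHS]innerZr adjE.
Qed.

Lemma adjopN H K (T : adjop H K) : (- T)^*o = - T^*o.
Proof. by rewrite -scaleN1r adjopZ rmorphN1 scaleN1r. Qed.

Lemma adjopB H K (S T : adjop H K) : (S - T)^*o = S^*o - T^*o.
Proof. by rewrite adjopD adjopN. Qed.

Lemma adj_comp H K L (S : adjop K L) (T : adjop H K) :
  (S \c T)^*o = T^*o \c S^*o.
Proof. by apply: is_adjoint_eq => x y /=; rewrite !adjE. Qed.

Lemma adjopM H (S T : adjop H H) : (S * T)^*o = T^*o * S^*o.
Proof. exact: adj_comp. Qed.

Lemma adjop1 H : (1 : adjop H H)^*o = 1.
Proof. by apply: is_adjoint_eq => x y. Qed.

Lemma mulopE H (S T : adjop H H) x : (S * T) x = S (T x).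
Proof. by []. Qed.

Lemma addopE H K (S T : adjop H K) x : (S + T) x = S x + T x.
Proof. by []. Qed.

Lemma oppopE H K (T : adjop H K) x : (- T) x = - T x.
Proof. by []. Qed.

Lemma scaleopE H K k (T : adjop H K) x : (k *: T) x = k *: T x.
Proof. by []. Qed.

Lemma oneopE H x : (1 : adjop H H) x = x.
Proof. by []. Qed.

Lemma compopE H K L (S : adjop K L) (T : adjop H K) x : (S \c T) x = S (T x).
Proof. by []. Qed.

Lemma adjop_map0 H K (T : adjop H K) : T 0 = 0.
Proof. exact: linear0. Qed.

Lemma adjop_mapD H K (T : adjop H K) x y : T (x + y) = T x + T y.
Proof. exact: linearD. Qed.

Lemma adjop_mapN H K (T : adjop H K) x : T (- x) = - T x.
Proof. exact: linearN. Qed.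

Lemma adjop_mapZ H K (T : adjop H K) k x : T (k *: x) = k *: T x.
Proof. exact: linearZ. Qed.

Definition adjop_mapE := (adjop_map0, adjop_mapD, adjop_mapN, adjop_mapZ).

Definition opE := (mulopE, addopE, oppopE, scaleopE, oneopE, compopE).

Lemma scaleop_mulr H (k : R[i]) (S T : adjop H H) : S * (k *: T) = k *: (S * T).
Proof. by apply: adjopP => x; rewrite !opE linearZ. Qed.

Lemma scaleop_mull H (k : R[i]) (S T : adjop H H) : (k *: S) * T = k *: (S * T).
Proof. by apply: adjopP => x; rewrite !opE. Qed.

Lemma op_invP H (T S : adjop H H) : S * T = 1 -> T * S = 1 -> op_inv T = S.
Proof.
move=> ST TS; have : op_inv T * T = 1 /\ T * op_inv T = 1.
  exact: (@xgetPex _ 0 [set S | S * T = 1 /\ T * S = 1]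
    (ex_intro _ S (conj ST TS))).
by case=> iT _; rewrite -[LHS]mulr1 -TS mulrA iT mul1r.
Qed.

(** Serves the degenerate cases, where every formula built on [op_inv] collapses to 0. *)
Lemma op_inv_out H (T : adjop H H) :
  ~ (exists S, S * T = 1 /\ T * S = 1) -> op_inv T = 0.
Proof. by move=> nT; apply: xgetPN => S ST; apply: nT; exists S. Qed.

End AdjointTheory.

(** * Norms read off from inner products *)

Section HilbertModuleNorm.
Local Open Scope complex_scope.
Context (R : realType) (A : cstarAlgType R) (H : hilbertModType A).
Implicit Types (x y z : H) (S T K : adjop H H).

Lemma rnorm_sq x : rnorm x ^+ 2 = rnorm (inner x x : A).
Proof. by apply: complexI; rewrite rmorphXn /= !rnormE hnormE. Qed.

Lemma rnorm_inner_eq x y : inner x x = inner y y :> A -> rnorm x = rnorm y.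
Proof.
move=> xy; apply/eqP; rewrite -(@eqrXn2 _ 2) ?rnorm_ge0//.
by rewrite !rnorm_sq xy.
Qed.

End HilbertModuleNorm.

(** * Square-zero extension of a module, for deciding linear identities *)

Section SquareZeroExtension.
Context (K : comNzRingType) (V : lmodType K).

Definition sqzero : Type := (K * V)%type.
HB.instance Definition _ := GRing.Zmodule.copy sqzero (K * V)%type.

Definition sqzero_one : sqzero := (1, 0).
Definition sqzero_mul (x y : sqzero) : sqzero :=
  (x.1 * y.1, x.1 *: y.2 + y.1 *: x.2).

Fact sqzero_mulA : associative sqzero_mul.
Proof.
move=> x y z; congr pair; rewrite /= ?mulrA// !scalerDr !scalerA.
by rewrite -addrA [z.1 * x.1]mulrC [z.1 * y.1]mulrC [y.1 * z.1]mulrC.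
Qed.
Fact sqzero_mulC : commutative sqzero_mul.
Proof. by move=> x y; congr pair; rewrite /= 1?mulrC// addrC. Qed.
Fact sqzero_mul1 : left_id sqzero_one sqzero_mul.
Proof. by case=> a v; rewrite /sqzero_mul /= mul1r scale1r scaler0 addr0. Qed.
Fact sqzero_mulDl : left_distributive sqzero_mul +%R.
Proof.
by move=> x y z; congr pair; rewrite /= ?mulrDl// scalerDl scalerDr addrACA.
Qed.
Fact sqzero_1neq0 : sqzero_one != 0.
Proof. by apply/eqP => -[] /eqP; rewrite oner_eq0. Qed.
HB.instance Definition _ := GRing.Zmodule_isComNzRing.Build sqzero
  sqzero_mulA sqzero_mulC sqzero_mul1 sqzero_mulDl sqzero_1neq0.

Definition sqzero_scal (k : K) : sqzero := (k, 0).
Fact sqzero_scal_additive : {morph sqzero_scal : x y / x - y}.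
Proof. by move=> x y; congr pair; rewrite /= subr0. Qed.
HB.instance Definition _ :=
  GRing.isZmodMorphism.Build K sqzero sqzero_scal sqzero_scal_additive.
Fact sqzero_scal_multiplicative : monoid_morphism sqzero_scal.
Proof.
by split=> // x y; congr pair; rewrite /= !scaler0 addr0.
Qed.
HB.instance Definition _ :=
  GRing.isMonoidMorphism.Build K sqzero sqzero_scal sqzero_scal_multiplicative.

Definition sqzero_vec (v : V) : sqzero := (0, v).
Lemma sqzero_vec_inj : injective sqzero_vec.
Proof. by move=> u v []. Qed.
Lemma sqzero_vec0 : sqzero_vec 0 = 0.
Proof. by []. Qed.
Lemma sqzero_vecD u v : sqzero_vec (u + v) = sqzero_vec u + sqzero_vec v.
Proof. by congr pair; rewrite /= addr0. Qed.
Lemma sqzero_vecN v : sqzero_vec (- v) = - sqzero_vec v.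
Proof. by congr pair; rewrite /= oppr0. Qed.
Lemma sqzero_vecZ k v : sqzero_vec (k *: v) = sqzero_scal k * sqzero_vec v.
Proof. by congr pair; rewrite /= ?mulr0// scale0r addr0. Qed.
Lemma sqzero_vecMn v n : sqzero_vec (v *+ n) = sqzero_vec v *+ n.
Proof. by elim: n => // n IH; rewrite !mulrS sqzero_vecD IH. Qed.
End SquareZeroExtension.

(* A module embeds in its square-zero extension, a commutative ring in which
   the action of scalars becomes multiplication. *)
Ltac module :=
  apply: sqzero_vec_inj;
  rewrite ?(sqzero_vec0, sqzero_vecD, sqzero_vecN, sqzero_vecZ, sqzero_vecMn);
  ring.


(** * Cauchy-Schwarz up to a constant *)

Section HilbertModule.
Local Open Scope complex_scope.
Context (R : realType) (A : cstarAlgType R) (H : hilbertModType A).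
Implicit Types (x y z : H) (S T K : adjop H H).

Lemma inner_sqD x y :
  inner (x + y) (x + y) = inner x x + inner x y + (inner y x + inner y y) :> A.
Proof. by rewrite innerDl !innerDr. Qed.

Lemma inner_sqB x y :
  inner (x - y) (x - y) = inner x x - inner x y - (inner y x - inner y y) :> A.
Proof.
rewrite -scaleN1r innerDl !innerDr !innerZl !innerZr rmorphN1.
by rewrite !scaleN1r; module.
Qed.

(** Polarization: the symmetric part is half the difference of the inner squares of x + y and x -
    y. *)
Lemma rnorm_inner_sym x y :
  rnorm (inner x y + inner y x : A) <= (rnorm x + rnorm y) ^+ 2.
Proof.
have -> : inner x y + inner y x = (2^-1)%:C *:
    (inner (x + y) (x + y) - inner (x - y) (x - y)) :> A.
  rewrite inner_sqD inner_sqB; set a := inner x x; set b := inner y y.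
  set c := inner x y; set d := inner y x.
  have -> : a + c + (d + b) - (a - c - (d - b)) = 2%:R%:C *: (c + d) by module.
  by rewrite scalerA -rmorphM /= mulVf// scale1r.
have sqle z : rnorm z <= rnorm x + rnorm y ->
    rnorm z ^+ 2 <= (rnorm x + rnorm y) ^+ 2.
  by move=> h; rewrite ler_pXn2r// nnegrE ?rnorm_ge0// addr_ge0 ?rnorm_ge0.
have := sqle _ (rnormD x y); have := sqle _ (rnormB x y).
rewrite rnormZ_ge0// !rnorm_sq.
have := rnormB (inner (x + y) (x + y) : A) (inner (x - y) (x - y)); lra.
Qed.

(** Replacing y by i y in the symmetric bound controls the antisymmetric part; the two parts add up
    to twice the inner product. *)
Lemma rnorm_inner_le_sq x y :
  rnorm (inner x y : A) <= (rnorm x + rnorm y) ^+ 2.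
Proof.
have h := rnorm_inner_sym x y; have := rnorm_inner_sym x ('i%C *: y).
rewrite innerZr innerZl rnormiZ normr1 mul1r => k.
have := rnormB (inner x y + inner y x : A)
  ((0 +i* 1) *: ('i%C *: inner x y + (0 +i* (- 1)) *: inner y x)).
rewrite rnormiZ normr1 mul1r scalerDr !scalerA.
have -> : 'i%C * 'i%C = -1 :> R[i] by rewrite -expr2 sqr_i.
have -> : 'i%C * (0 +i* (- 1)) = 1 :> R[i].
  by apply/eqP; rewrite eq_complex /=; apply/andP; split; apply/eqP; ring.
have -> : inner x y + inner y x - (-1 *: inner x y + 1 *: inner y x) =
    2%:R%:C *: inner x y :> A.
  set a := inner x y; set b := inner y x; module.
rewrite rnormZ_ge0//; lra.
Qed.

(* The constant 4 instead of 1 suffices and avoids the order of A. *)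
Lemma weak_Cauchy_Schwarz x y :
  rnorm (inner x y : A) <= 4 * rnorm x * rnorm y.
Proof.
have [/rnorm0_eq0 ->|nx] := eqVneq (rnorm x) 0.
  by rewrite inner0l !rnorm0 mulr0 mul0r.
have [/rnorm0_eq0 ->|ny] := eqVneq (rnorm y) 0.
  by rewrite inner0r !rnorm0 mulr0.
have x0 : 0 < rnorm x by rewrite lt_neqAle eq_sym nx rnorm_ge0.
have y0 : 0 < rnorm y by rewrite lt_neqAle eq_sym ny rnorm_ge0.
(* For unit vectors the previous bound is (1 + 1)^2 = 4. *)
have := rnorm_inner_le_sq ((rnorm x)^-1%:C *: x) ((rnorm y)^-1%:C *: y).
rewrite innerZl innerZr conjC_real !rnormZ_ge0 ?invr_ge0 ?rnorm_ge0//.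
rewrite !mulVf// ler_pdivrMl// ler_pdivrMl// => /le_trans; apply.
by rewrite le_eqVlt; apply/orP; left; apply/eqP; ring.
Qed.

(** * Bounded operators and projections *)

Definition bounded_by (c : R) T := forall x, rnorm (T x) <= c * rnorm x.

(** Explicit bounds, established operator by operator, take the place of the uniform boundedness
    principle; they make the supremum [opnorm] meaningful. *)
Definition bounded T := exists2 c, 0 <= c & bounded_by c T.

Lemma bounded_byW c d T : c <= d -> bounded_by c T -> bounded_by d T.
Proof.
by move=> cd cT x; rewrite (le_trans (cT x))// ler_wpM2r// rnorm_ge0.
Qed.

Lemma bounded_byM c d S T :
  0 <= c -> bounded_by c S -> bounded_by d T -> bounded_by (c * d) (S * T).
Proof.
by move=> c0 cS dT x; rewrite (le_trans (cS _))// -mulrA ler_wpM2l.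
Qed.

Lemma bounded_byD c d S T :
  bounded_by c S -> bounded_by d T -> bounded_by (c + d) (S + T).
Proof.
move=> cS dT x; by rewrite (le_trans (rnormD _ _))// mulrDl lerD ?cS ?dT.
Qed.

Lemma bounded_byN c T : bounded_by c T -> bounded_by c (- T).
Proof. by move=> cT x; rewrite opE rnormN. Qed.

Lemma bounded_byB c d S T :
  bounded_by c S -> bounded_by d T -> bounded_by (c + d) (S - T).
Proof. by move=> cS dT; apply: bounded_byD => //; apply: bounded_byN. Qed.

Lemma bounded_by1 : bounded_by 1 1.
Proof. by move=> x; rewrite mul1r. Qed.

Lemma boundedM S T : bounded S -> bounded T -> bounded (S * T).
Proof.
move=> [c c0 cS] [d d0 dT].
by exists (c * d); [exact: mulr_ge0|exact: bounded_byM].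
Qed.

Lemma boundedD S T : bounded S -> bounded T -> bounded (S + T).
Proof.
move=> [c c0 cS] [d d0 dT].
by exists (c + d); [exact: addr_ge0|exact: bounded_byD].
Qed.

Lemma boundedB S T : bounded S -> bounded T -> bounded (S - T).
Proof.
move=> [c c0 cS] [d d0 dT].
by exists (c + d); [exact: addr_ge0|exact: bounded_byB].
Qed.

(** The inner square of T x is that of x with T^* T x, so Cauchy-Schwarz with constant 4 bounds the
    squared norm by 4 c times that of x. *)
Lemma bounded_by_adj_comp c T :
  0 <= c -> bounded_by c (T^*o * T) -> bounded_by (2 * Num.sqrt c) T.
Proof.
move=> c0 cT x; rewrite -(@ler_pXn2r _ 2) ?nnegrE ?rnorm_ge0//; last first.
  by rewrite !mulr_ge0 ?sqrtr_ge0 ?rnorm_ge0.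
rewrite rnorm_sq adjE (le_trans (weak_Cauchy_Schwarz _ _))//.
rewrite !exprMn sqr_sqrtr//.
have := cT x; rewrite opE; have := rnorm_ge0 x; move: (rnorm _) => u; nra.
Qed.

(** The squared norm of T^* x is at most 4 times the norms of x and T T^* x; one factor, the norm of
    T^* x, cancels. *)
Lemma bounded_by_adj c T :
  0 <= c -> bounded_by c T -> bounded_by (4 * c) T^*o.
Proof.
move=> c0 cT x; have [->|nx] := eqVneq (rnorm (T^*o x)) 0.
  by rewrite !mulr_ge0 ?rnorm_ge0.
have Tx0 : 0 < rnorm (T^*o x) by rewrite lt_neqAle eq_sym nx rnorm_ge0.
rewrite -(ler_pM2l Tx0) -expr2 rnorm_sq adj_inner.
rewrite (le_trans (weak_Cauchy_Schwarz _ _))//.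
have := cT (T^*o x); have := rnorm_ge0 x; nra.
Qed.

Lemma bounded_adj T : bounded T -> bounded T^*o.
Proof.
by move=> [c c0 cT]; exists (4 * c); [exact: mulr_ge0|exact: bounded_by_adj].
Qed.

Lemma bounded_by_isometry T : T^*o * T = 1 -> bounded_by 1 T.
Proof.
move=> TT x; rewrite mul1r (rnorm_inner_eq (y := x))// adjE.
by rewrite -[T^*o (T x)]/((T^*o * T) x) TT.
Qed.

(* 2P - 1 is unitary and P is the mean of 1 and 2P - 1. *)
Lemma projection_reflection P : is_projection P ->
  bounded_by 1 (P + P - 1).
Proof.
move=> [PP Pa]; apply: bounded_by_isometry; rewrite adjopB adjopD adjop1 Pa.
rewrite mulrBr mulr1 mulrBl mul1r mulrDr !mulrDl PP; module.
Qed.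

Lemma bounded_by_half c T : bounded_by (2 * c) (T + T) -> bounded_by c T.
Proof.
move=> cT x; have := cT x; rewrite opE.
have -> : T x + T x = 2%:R%:C *: T x by module.
rewrite rnormZ_ge0//; lra.
Qed.

Lemma projection_bounded P : is_projection P -> bounded_by 1 P.
Proof.
move=> /projection_reflection PR; apply: bounded_by_half.
have -> : P + P = (P + P - 1) + 1 by rewrite subrK.
by rewrite mulr1; apply: bounded_byD => //; exact: bounded_by1.
Qed.

Lemma projectionB_bounded P P' : is_projection P -> is_projection P' ->
  bounded_by 1 (P - P').
Proof.
move=> /projection_reflection PR /projection_reflection PR'.
apply: bounded_by_half; rewrite mulr1.
have -> : P - P' + (P - P') = (P + P - 1) - (P' + P' - 1) by module.
exact: bounded_byB.
Qed.

(** * The operator norm as the least bound *)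

Lemma opnorm_le c T : 0 <= c -> bounded_by c T -> opnorm T <= c.
Proof.
move=> c0 cT; apply: ge_sup.
  by exists (rnorm (T 0)); exists 0; rewrite //= normr0.
move=> _ [x x1 <-]; rewrite (le_trans (cT x))// ler_piMr//.
by move: x1; rewrite /= -rnormE lecR.
Qed.

Lemma opnorm_has_ubound T : bounded T ->
  has_ubound [set complex.Re `|T x| | x in [set x : H | `|x| <= 1]]%classic.
Proof.
move=> [c c0 cT]; exists c => _ [x x1 <-].
rewrite (le_trans (cT x))// ler_piMr//.
by move: x1; rewrite /= -rnormE lecR.
Qed.

Lemma bounded_by_opnorm T : bounded T -> bounded_by (opnorm T) T.
Proof.
move=> /opnorm_has_ubound/ub_le_sup Tub x; have [x0|nx] := eqVneq (rnorm x) 0.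
  by rewrite (rnorm0_eq0 x0) linear0 !rnorm0 mulr0.
have x0 : 0 < rnorm x by rewrite lt_neqAle eq_sym nx rnorm_ge0.
rewrite mulrC -ler_pdivrMl// -rnormZ_ge0 ?invr_ge0 ?rnorm_ge0// -linearZ.
apply: Tub; exists ((rnorm x)^-1%:C *: x) => //=.
by rewrite -rnormE rnormZ_ge0 ?invr_ge0 ?rnorm_ge0// mulVf.
Qed.

Lemma opnorm_ge0 T : bounded T -> 0 <= opnorm T.
Proof.
move=> /opnorm_has_ubound/ub_le_sup; apply; exists 0; rewrite /= ?normr0//.
by rewrite linear0 normr0.
Qed.

End HilbertModule.

(** * Banach's fixed point theorem *)

Section FixedPoint.
Local Open Scope complex_scope.
Local Open Scope classical_set_scope.
Context (R : realType) (V : completeNormedModType R[i]).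

Lemma expr_lt_eps (q r e : R) : 0 <= q < 1 -> 0 < e ->
  exists n, q ^+ n * r < e.
Proof.
move=> /andP[q0 q1] e0.
have qr : q ^+ n * r @[n --> \oo] --> 0 * r.
  by apply: cvgM (cvg_cst _) => //; apply: cvg_expr; rewrite ger0_norm.
have /cvgrPdist_lt/(_ e e0)[N _ h] := qr.
exists N; have := h N (leqnn N).
by rewrite mul0r distrC subr0; apply: le_lt_trans; exact: ler_norm.
Qed.

Lemma contraction_fixpoint (f : V -> V) (q : R) : 0 <= q < 1 ->
  (forall x y, rnorm (f x - f y) <= q * rnorm (x - y)) -> exists x, f x = x.
Proof.
move=> q01 fq; have /andP[q0 q1] := q01.
(* The radius r solves q r + |f 0| = r, so f maps the ball of radius r about 0 into itself and all
   iterates stay there. *)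
pose u n := iter n f 0; pose r := rnorm (f 0) / (1 - q).
have r_ge0 : 0 <= r by rewrite divr_ge0 ?rnorm_ge0// subr_ge0 ltW.
have fr : rnorm (f 0) = (1 - q) * r by rewrite /r mulrC divfK// subr_eq0 gt_eqF.
have ur m : rnorm (u m) <= r.
  elim: m => [|m IH]; first by rewrite rnorm0.
  rewrite /u iterS -/(u m) -(subrK (f 0) (f (u m))) (le_trans (rnormD _ _))//.
  have := fq (u m) 0; rewrite subr0 fr; move: IH.
  have := rnorm_ge0 (u m); nra.
have udist n m : rnorm (u (n + m)%N - u n) <= q ^+ n * r.
  elim: n => [|n IH]; first by rewrite add0n expr0 mul1r subr0.
  by rewrite addSn (le_trans (fq _ _))// exprS -mulrA ler_wpM2l.
have /cauchy_cvg ucvg : cauchy (u @ \oo).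
  apply: cauchy_exP => e e0.
  have eE : (complex.Re e)%:C = e by rewrite RRe_real// gtr0_real.
  have [n nlt] : exists n, q ^+ n * r < complex.Re e.
    by apply: expr_lt_eps => //; rewrite -ltcR eE.
  exists (u n); exists n => // m /= nm; rewrite -ball_normE /= distrC.
  rewrite -rnormE -eE ltcR (le_lt_trans _ nlt)//.
  by rewrite -(subnKC nm) udist.
have /cvgrPdist_lt ul : u @ \oo --> lim (u @ \oo) by [].
exists (lim (u @ \oo)); set l := lim _ in ul *.
apply/eqP; rewrite -subr_eq0; apply/eqP/rnorm0_eq0/eqP.
rewrite eq_le rnorm_ge0 andbT; apply/ler_addgt0Pr => e e0; rewrite add0r.
have e2 : 0 < (e / 2)%:C by rewrite ltcR divr_gt0.
have [N _ h] := ul _ e2.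
have := h N (leqnn N); have := h N.+1 (leqnSn N).
rewrite /= -!rnormE !ltcR => h1 h2.
have -> : f l - l = (f l - u N.+1) - (l - u N.+1) by module.
rewrite (le_trans (rnormB _ _))//.
have := fq l (u N); rewrite -/(u N.+1); have := rnorm_ge0 (l - u N); nra.
Qed.
End FixedPoint.

(** * Self-adjoint operators: imaginary shifts, invertibility, accretivity *)

Section SelfAdjoint.
Local Open Scope complex_scope.
Context (R : realType) (A : cstarAlgType R) (H : hilbertModType A).
Implicit Types (x y z : H) (S T K G W C : adjop H H).

(** The cross terms cancel because T is self-adjoint and i r is imaginary: both inner squares are
    that of T x plus r^2 times that of x. *)
Lemma rnorm_selfadjoint_shift T (r : R) x : T^*o = T ->
  rnorm (T x + (0 +i* r) *: x) = rnorm (T x - (0 +i* r) *: x).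
Proof.
move=> Ta; apply: rnorm_inner_eq; rewrite inner_sqD inner_sqB.
rewrite !innerZr !innerZl conjC_imag -[inner x (T x)]adj_inner Ta.
have -> : 0 +i* (- r) = - (0 +i* r) :> R[i] by rewrite /GRing.opp /= oppr0.
by module.
Qed.

(** T x is half the sum of the two shifted vectors, which have equal norm; their half-difference
    serves in the next lemma. *)
Lemma rnorm_le_shift T (r : R) x : T^*o = T ->
  rnorm (T x) <= rnorm (T x + (0 +i* r) *: x).
Proof.
move=> Ta; have h := rnorm_selfadjoint_shift r x Ta.
have := rnormD (T x + (0 +i* r) *: x) (T x - (0 +i* r) *: x).
rewrite -h.
have -> : T x + (0 +i* r) *: x + (T x - (0 +i* r) *: x) = 2%:R%:C *: T x.
  by module.
rewrite rnormZ_ge0//; lra.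
Qed.

Lemma rnormZ_le_shift T (r : R) x : T^*o = T ->
  `|r| * rnorm x <= rnorm (T x + (0 +i* r) *: x).
Proof.
move=> Ta; have h := rnorm_selfadjoint_shift r x Ta.
have := rnormB (T x + (0 +i* r) *: x) (T x - (0 +i* r) *: x).
rewrite -h.
have -> : T x + (0 +i* r) *: x - (T x - (0 +i* r) *: x) =
    2%:R%:C *: ((0 +i* r) *: x).
  by module.
rewrite rnormZ_ge0// rnormiZ; lra.
Qed.

Definition onto T := forall y, exists x, T x = y.

(** A solution of T x + K x = y is a fixed point of x -> g (y - K x), with g a right inverse of T;
    the lower bound a makes this map a contraction of ratio b / a. *)
Lemma onto_perturb T K (a b : R) : 0 <= b < a ->
  (forall x, a * rnorm x <= rnorm (T x)) -> bounded_by b K ->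
  onto T -> onto (T + K).
Proof.
move=> /andP[b0 ba] aZ bK /choice[g gZ] y.
have a0 : 0 < a by exact: le_lt_trans ba.
have [||x fx] := @contraction_fixpoint R H (fun x => g (y - K x)) (b / a).
- by rewrite divr_ge0 ?(ltW a0)// ltr_pdivrMr// mul1r.
- move=> u v; rewrite mulrAC ler_pdivlMr// mulrC (le_trans (aZ _))//.
  rewrite /= !(adjop_mapE, gZ); have := bK (v - u); rewrite !adjop_mapE.
  by congr (rnorm _ <= b * _); [module|rewrite rnormC].
by exists x; rewrite opE -{1}fx gZ subrK.
Qed.

(* T + i r is bounded below by d uniformly in r, so surjectivity propagates
   from large r down to r = 0 in steps of d / 2. *)
Lemma selfadjoint_onto T (c d : R) : T^*o = T -> 0 <= c -> bounded_by c T ->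
  0 < d -> (forall x, d * rnorm x <= rnorm (T x)) -> onto T.
Proof.
move=> Ta c0 cT d0 dT.
pose Z (r : R) : adjop H H := T + (0 +i* r) *: (1 : adjop H H).
(* The initial shift n d / 2 exceeds the bound c of T, so T is a small perturbation of the
   invertible scalar i n d / 2. *)
have [n nP] : exists n : nat, c < n%:R * (d / 2).
  exists (Num.truncn (c / (d / 2))).+1.
  by rewrite -ltr_pdivrMr ?divr_gt0// truncnS_gt.
have : onto (Z (n%:R * (d / 2))).
  have r0 : 0 < n%:R * (d / 2) by exact: le_lt_trans nP.
  rewrite /Z addrC; apply: (@onto_perturb _ _ (n%:R * (d / 2)) c) => //.
  - by rewrite c0.
  - by move=> x; rewrite !opE rnormiZ gtr0_norm.
  - move=> y; exists ((0 +i* (n%:R * (d / 2)))^-1 *: y).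
    rewrite !opE scalerA divff ?scale1r// eq_complex /= eqxx /=.
    by rewrite gt_eqF.
elim: n {nP} => [|n IH] oZ.
  move=> y; have [x <-] := oZ y; exists x; rewrite !opE mul0r.
  by have -> : 0 +i* 0 = 0 :> R[i] by []; rewrite scale0r addr0.
apply: IH; have -> : Z (n%:R * (d / 2)) =
    Z (n.+1%:R * (d / 2)) + (0 +i* (- (d / 2))) *: (1 : adjop H H).
  rewrite /Z -addrA -scalerDl; congr (_ + _ *: _).
  apply/eqP; rewrite eq_complex /= addr0 eqxx /=; apply/eqP.
  by rewrite -natr1; ring.
apply: (@onto_perturb _ _ d (d / 2)) => //.
- by apply/andP; split; lra.
- by move=> x; rewrite (le_trans (dT x))// !opE rnorm_le_shift.
- by move=> x; rewrite !opE rnormiZ normrN gtr0_norm// divr_gt0.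
Qed.

(** The lower bound gives injectivity, and the set-theoretic inverse is its own adjoint, hence
    adjointable. *)
Lemma selfadjoint_invertible T (c d : R) : T^*o = T -> 0 <= c ->
  bounded_by c T -> 0 < d -> (forall x, d * rnorm x <= rnorm (T x)) ->
  exists S, S * T = 1 /\ T * S = 1.
Proof.
move=> Ta c0 cT d0 dT; have /choice[g Tg] := selfadjoint_onto Ta c0 cT d0 dT.
have Tinj x y : T x = T y -> x = y.
  move=> Txy; apply/eqP; rewrite -subr_eq0; apply/eqP/rnorm0_eq0/eqP.
  rewrite eq_le rnorm_ge0 andbT -(ler_pM2l d0) mulr0 (le_trans (dT _))//.
  by rewrite !adjop_mapE Txy subrr rnorm0.
have gadj : g \in @adjointable R A H H.
  by apply/asboolP; exists g => x y; rewrite -{1}(Tg y) -{2}(Tg x) adjE Ta.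
exists (AdjOp gadj); split; apply: adjopP => x; rewrite !opE /=.
  by apply: Tinj; rewrite Tg.
by rewrite Tg.
Qed.

(* Equivalent to ||(T + s) x|| >= s ||x|| for all s > 0; this form makes the
   stability under sums immediate, where the order of A would otherwise be
   needed. *)
Definition accretive T := exists2 c : R, 0 < c & forall (t : R) x, 0 <= t ->
  t * c <= 1 -> rnorm (x - t%:C *: T x) <= (1 + c * t ^+ 2) * rnorm x.

(** x - t (S + T) x is the mean of x - 2 t S x and x - 2 t T x; the constant 4 (c + d) leaves room
    for the doubled t. *)
Lemma accretiveD S T : accretive S -> accretive T -> accretive (S + T).
Proof.
move=> [c c0 cS] [d d0 dT]; exists (4 * (c + d)); first by nra.
move=> t x t0 tcd; have tt0 : 0 <= 2 * t by lra.
have /(_ _) h1 := cS (2 * t) x tt0; have /(_ _) h2 := dT (2 * t) x tt0.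
have {}h1 := h1 ltac:(nra); have {}h2 := h2 ltac:(nra).
rewrite -(@ler_pM2l _ 2)// -[leLHS]rnormZ_ge0//.
have -> : 2%:R%:C *: (x - t%:C *: (S + T) x) =
    (x - (2 * t)%:C *: S x) + (x - (2 * t)%:C *: T x) by rewrite opE; module.
rewrite (le_trans (rnormD _ _))// (le_trans (lerD h1 h2))//.
have : 0 <= (c + d) * t ^+ 2 * rnorm x.
  by rewrite !mulr_ge0 ?rnorm_ge0 ?sqr_ge0// addr_ge0// ltW.
lra.
Qed.

Lemma accretiveZ (s : R) T : 0 <= s -> accretive T -> accretive (s%:C *: T).
Proof.
move=> s0 [c c0 cT]; exists (c * s ^+ 2 + c * s + 1); first by nra.
move=> t x t0 tc; rewrite opE scalerA -rmorphM /=.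
rewrite (le_trans (cT (t * s) x _ _))//; first exact: mulr_ge0.
  by nra.
rewrite ler_wpM2r ?rnorm_ge0//.
have : 0 <= (c * s + 1) * t ^+ 2.
  by rewrite mulr_ge0 ?sqr_ge0// addr_ge0// mulr_ge0// ltW.
lra.
Qed.

(** t (e x + T x) = (1 + t e) x - (x - t T x), with t so small that the error c t^2 is at most t e /
    2. *)
Lemma accretive_bounded_below T (e : R) x : 0 < e -> accretive T ->
  (e / 2) * rnorm x <= rnorm (e%:C *: x + T x).
Proof.
move=> e0 [c c0 cT].
have [t t0 [tc te]] : exists2 t : R, 0 < t & t * c <= 1 /\ 2 * c * t <= e.
  exists (Num.min c^-1 (e / (2 * c))).
    by rewrite lt_min invr_gt0 c0 divr_gt0 ?mulr_gt0.
  split; first by rewrite -ler_pdivlMr// mul1r ge_min lexx.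
  by rewrite mulrC -ler_pdivlMr ?mulr_gt0// ge_min lexx orbT.
rewrite -(@ler_pM2l _ t)// -(rnormZ_ge0 _ (ltW t0)).
have -> : t%:C *: (e%:C *: x + T x) =
    (1 + t * e)%:C *: x - (x - t%:C *: T x) by module.
have := rnormD ((1 + t * e)%:C *: x - (x - t%:C *: T x)) (x - t%:C *: T x).
rewrite subrK rnormZ_ge0; last by nra.
have := cT t x (ltW t0) tc.
have : c * t ^+ 2 * rnorm x <= t * e / 2 * rnorm x.
  by rewrite ler_wpM2r ?rnorm_ge0//; nra.
lra.
Qed.

(** For t in [0, 1], x - t (1 - T) x is a convex combination of x and T x. *)
Lemma accretive_contraction T : bounded_by 1 T -> accretive (1 - T).
Proof.
move=> T1; exists 1 => // t x t0; rewrite mulr1 => t1.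
have -> : x - t%:C *: (1 - T) x = (1 - t)%:C *: x + t%:C *: T x.
  by rewrite !opE; module.
rewrite (le_trans (rnormD _ _))// !rnormZ_ge0 ?subr_ge0//.
have := T1 x; have := rnorm_ge0 x; nra.
Qed.

(** With G = sqrt(t) T, 1 + t T^2 = (G - i) (G + i) does not decrease norms, since neither factor
    does. Applied to x - t T^2 x it yields x - t^2 T^4 x, and the bound on T^4 gives the
    constant. *)
Lemma accretive_sq T : T^*o = T -> bounded T -> accretive (T * T).
Proof.
move=> Ta [c c0 cT].
have below t x : 0 <= t -> rnorm x <= rnorm (x + t%:C *: (T * T) x).
  move=> t0; pose s := Num.sqrt t; pose G : adjop H H := s%:C *: T.
  have GE y : G y = s%:C *: T y by [].
  have Ga : G^*o = G by rewrite /G adjopZ conjC_real Ta.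
  clearbody G.
  have low y r : `|r| = 1 -> rnorm y <= rnorm (G y + (0 +i* r) *: y).
    by move=> r1; rewrite -[leLHS]mul1r -r1 rnormZ_le_shift.
  have -> : x + t%:C *: (T * T) x =
      G (G x + (0 +i* 1) *: x) + (0 +i* (- 1)) *: (G x + (0 +i* 1) *: x).
    have <- : s * s = t by rewrite -expr2 sqr_sqrtr.
    have -> : 0 +i* (- 1) = - (0 +i* 1) :> R[i] by rewrite /GRing.opp /= oppr0.
    have ii : (0 +i* 1) *: ((0 +i* 1) *: x) = - x.
      by rewrite scalerA -expr2 sqr_i scaleN1r.
    rewrite !adjop_mapE scaleNr [_ *: (G x + _)]scalerDr ii.
    by rewrite !GE !(opE, adjop_mapE); module.
  by rewrite (le_trans (low x 1 _)) ?normr1// low// normrN normr1.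
have c4 : bounded_by (c * c * (c * c)) (T * T * (T * T)).
  by do 2 ?apply: bounded_byM; rewrite ?mulr_ge0.
exists (c * c * (c * c) + 1); first by rewrite ltr_wpDl// !mulr_ge0.
move=> t x t0 _; rewrite (le_trans (below t _ t0))//.
have -> : x - t%:C *: (T * T) x + t%:C *: (T * T) (x - t%:C *: (T * T) x) =
    x - (t ^+ 2)%:C *: (T * T * (T * T)) x.
  by rewrite !(adjop_mapE, opE); module.
rewrite (le_trans (rnormB _ _))// rnormZ_ge0 ?sqr_ge0//.
have := c4 x; have := rnorm_ge0 x; have := sqr_ge0 t.
rewrite -/(bounded_by _ _); nra.
Qed.

End SelfAdjoint.

(** * Excluding -1 from the spectrum of a contraction *)

Section PositiveShift.
Local Open Scope complex_scope.
Context (R : realType) (A : cstarAlgType R) (H : hilbertModType A).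
Implicit Types (x y z : H) (S T K G W C : adjop H H).

Lemma bounded_byZ (c s : R) T :
  0 <= s -> bounded_by c T -> bounded_by (s * c) (s%:C *: T).
Proof. by move=> s0 cT x; rewrite opE rnormZ_ge0// -mulrA ler_wpM2l. Qed.

Lemma adjoint_square_sum W :
  exists G K, [/\ G^*o = G, K^*o = K, bounded W -> bounded G /\ bounded K &
    G * G + K * K = 2%:R%:C *: (W * W^*o + W^*o * W)].
Proof.
exists (W + W^*o), ((0 +i* 1) *: (W - W^*o)); split.
- by rewrite adjopD adjopK addrC.
- have i_opp : 0 +i* (- 1) = - (0 +i* 1) :> R[i] by rewrite /GRing.opp /= oppr0.
  by rewrite adjopZ adjopB adjopK conjC_imag i_opp; module.
- move=> bW; have bWa := bounded_adj bW; split.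
    exact: boundedD.
  have [c c0 cW] := boundedB bW bWa; exists c => // x.
  by rewrite opE rnormiZ normr1 mul1r.
- have ii : (0 +i* 1) * (0 +i* 1) = -1 :> R[i] by rewrite -expr2 sqr_i.
  rewrite scaleop_mulr scaleop_mull scalerA ii.
  by rewrite !(mulrDl, mulrDr, mulrN, mulNr, opprK); module.
Qed.

(* C (1 - C)^2 / 4 is -1 at C = -1 and at most 1/2 on [-1, 1].  Since
   W W^* + W^* W is a sum of squares, W W^* >= -1/2, so that -1 is not in the
   spectrum of W W^*, hence not in that of W^* W, nor in that of C. *)
Lemma add1_invertible C W : C^*o = C -> bounded_by 1 C ->
  W^*o * W = 4^-1%:C *: (C * ((1 - C) * (1 - C))) ->
  exists S, S * (1 + C) = 1 /\ (1 + C) * S = 1.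
Proof.
move=> Ca C1 WW; have C0 : bounded C by exists 1.
have M1 : bounded_by 1 (W^*o * W).
  rewrite WW; apply: (@bounded_byW _ _ _ (4^-1 * (1 * ((1 + 1) * (1 + 1))))).
    lra.
  apply: bounded_byZ => //; apply: bounded_byM => //.
  by apply: bounded_byM => //; apply: bounded_byB => //; exact: bounded_by1.
have W2 : bounded_by 2 W.
  by have := bounded_by_adj_comp ler01 M1; rewrite sqrtr1 mulr1.
have Wa8 : bounded_by 8 W^*o.
  by have := bounded_by_adj (ler0n _ 2) W2; congr (bounded_by _ _); ring.
have C1' x : rnorm (C x) <= rnorm x by have := C1 x; rewrite mul1r.
have bW : bounded W by exists 2 => //; exact: ler0n.
have [G [K [Ga Ka /(_ bW)[bG bK] GK]]] := adjoint_square_sum W.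
have acc : accretive (2^-1%:C *: (1 : adjop H H) + W * W^*o).
  (* Substitute W W^* = (G^2 + K^2) / 2 - C (1 - C)^2 / 4 and expand: 1/2 - C (1 - C)^2 / 4 = (1 -
     C) / 4 + (1 - C^3) / 4 + C^2 / 2. Every summand is accretive. *)
  have -> : 2^-1%:C *: (1 : adjop H H) + W * W^*o =
      2^-1%:C *: (G * G) + 2^-1%:C *: (K * K) + 4^-1%:C *: (1 - C) +
      4^-1%:C *: (1 - C * (C * C)) + 2^-1%:C *: (C * C).
    rewrite -[2^-1%:C *: (G * G) + _]scalerDr GK scalerDr WW.
    rewrite !(mulrDl, mulrDr, mulrN, mulNr, mul1r, mulr1, opprK).
    set c3 := C * (C * C); set c2 := C * C; set n := W * W^*o.
    have e2 : 2^-1%:C = 2%:R%:C * 4^-1%:C :> R[i].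
      by rewrite -rmorphM /=; congr _%:C; field.
    have half X : 2^-1%:C *: (2%:R%:C *: X) = X :> adjop H H.
      by rewrite scalerA -rmorphM /= mulVf// scale1r.
    by rewrite -scalerDr half e2; module.
  have accC3 : accretive (1 - C * (C * C)).
    by apply: accretive_contraction => x; rewrite mul1r !opE !(le_trans (C1' _)).
  have accC : accretive (1 - C) by exact: accretive_contraction.
  have [accG accK] := (accretive_sq Ga bG, accretive_sq Ka bK).
  have accC2 := accretive_sq Ca C0.
  have q0 : 0 <= 4^-1 :> R by rewrite invr_ge0.
  have h0 : 0 <= 2^-1 :> R by rewrite invr_ge0.
  have sG := accretiveZ h0 accG; have sK := accretiveZ h0 accK.
  have sC := accretiveZ q0 accC; have sC3 := accretiveZ q0 accC3.
  have sC2 := accretiveZ h0 accC2.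
  exact: accretiveD (accretiveD (accretiveD (accretiveD sG sK) sC) sC3) sC2.
have low y : 4^-1 * rnorm y <= rnorm (y + (W * W^*o) y).
  have -> : 4^-1 = 2^-1 / 2 :> R by field.
  have -> : y + (W * W^*o) y =
      2^-1%:C *: y + (2^-1%:C *: (1 : adjop H H) + W * W^*o) y.
    rewrite !opE addrA -scalerDl -rmorphD /=.
    have -> : 2^-1 + 2^-1 = 1 :> R by field.
    by rewrite scale1r.
  exact: accretive_bounded_below.
(* Here 130 = 2 + 128: if r is the norm of (1 + C) u, then u + W^* W u has norm at most 2 r, W u at
   most 16 r, and W^* W u at most 8 times 16 r. *)
apply: (@selfadjoint_invertible _ _ _ _ 2 130^-1) => //.
- by rewrite adjopD adjop1 Ca.
- exact: (bounded_byD (@bounded_by1 _ _ _)).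
move=> u; set r := leRHS.
(* The quotient in 1 + C (1 - C)^2 / 4 = (1 + C) q. *)
pose q : adjop H H :=
  4^-1%:C *: (4%:R%:C *: (1 : adjop H H) - 3%:R%:C *: C + C * C).
have q2 : bounded_by 2 q.
  apply: (@bounded_byW _ _ _ (4^-1 * (4 * 1 + 3 * 1 + 1 * 1))); first lra.
  apply: bounded_byZ => //; apply: bounded_byD; last exact: bounded_byM.
  by apply: bounded_byB; apply: bounded_byZ => //; exact: bounded_by1.
have uM : u + (W^*o * W) u = q ((1 + C) u).
  have uE : u = (4%:R%:C * 4^-1%:C) *: u by rewrite -rmorphM /= divff// scale1r.
  by rewrite WW /q !opE !adjop_mapE {1}uE; module.
have h1 : rnorm (u + (W^*o * W) u) <= 2 * r by rewrite uM; exact: q2.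
have h2 : 4^-1 * rnorm (W u) <= 2 * (2 * r).
  rewrite (le_trans (low _))//.
  (* W intertwines 1 + W^* W and 1 + W W^*, carrying the lower bound of the latter over to the
     former. *)
  have -> : W u + (W * W^*o) (W u) = W (u + (W^*o * W) u).
    by rewrite !(opE, adjop_mapE).
  by rewrite (le_trans (W2 _))// ler_wpM2l.
have h3 : rnorm ((W^*o * W) u) <= 8 * rnorm (W u) by exact: Wa8.
have := rnormB (u + (W^*o * W) u) ((W^*o * W) u); rewrite addrK.
have := rnorm_ge0 (u + (W^*o * W) u); lra.
Qed.

End PositiveShift.

(** * The block matrix over two orthogonal components of H *)

Section BlockProjection.
Local Open Scope complex_scope.
Context (R : realType) (A : cstarAlgType R) (H : hilbertModType A).

Lemma selfadjoint_inverse (X : innerModType A) (S T : adjop X X) :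
  T^*o = T -> S * T = 1 -> T * S = 1 -> S^*o = S.
Proof.
move=> Ta ST TS; rewrite -[LHS]mulr1 -TS mulrA.
by rewrite -[X in _ * X * _]Ta -adjopM TS adjop1 mul1r.
Qed.

Context (X Y : innerModType A) (U1 : adjop H X) (U2 : adjop H Y).
Context (A0 : adjop Y X) (B S C : adjop X X).
Hypotheses (U1K : cancel U1^*o U1) (U2K : cancel U2^*o U2).
Hypothesis U12 : forall y, U1 (U2^*o y) = 0.
Hypotheses (B_pos : B = S^*o * S) (B_sq : B * B = A0 \c A0^*o + 1).
Hypotheses (CB : C * B = 1) (BC : B * C = 1).

Let Ba : B^*o = B.
Proof. by rewrite B_pos adjopM adjopK. Qed.

Let Ca : C^*o = C.
Proof. exact: selfadjoint_inverse Ba CB BC. Qed.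

Let U21 x : U2 (U1^*o x) = 0.
Proof.
by apply: inner_right_inj => y; rewrite inner0r -adj_inner -adjE U12 inner0l.
Qed.

(** X carries no completeness, so operators on X are transported to H, where the invertibility
    results apply. *)
Let lift (T : adjop X X) : adjop H H := U1^*o \c (T \c U1).

Lemma block_lift_contraction x :
  rnorm (U1^*o (C (U1 x))) <= rnorm x.
Proof.
have P1 : is_projection (U1^*o \c U1).
  by split; [apply: adjopP => z; rewrite !opE U1K|rewrite adj_comp adjopK].
have Pb z : rnorm (U1^*o (U1 z)) <= rnorm z.
  by have := projection_bounded P1 z; rewrite mul1r.
(* The vector v has first component y = C u and, since B^2 = 1 + A0 A0^*, the same inner square as B
   y = u. Projecting v onto the first component gives the contraction bound. *)
set u := U1 x; set y := C u; pose v := U1^*o y + U2^*o (A0^*o y).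
have <- : U1^*o (U1 v) = U1^*o y.
  by rewrite /v !adjop_mapD U1K U12 adjop_map0 addr0.
rewrite (le_trans (Pb v))// (le_trans _ (Pb x))// -/u.
rewrite (@rnorm_inner_eq _ _ _ v (U1^*o u))//.
have uE : u = B y by rewrite /y -[RHS]/((B * C) u) BC.
rewrite /v innerDl !innerDr !adj_inner !U1K !U2K U12 U21 adjop_map0.
rewrite !inner0r add0r addr0.
rewrite uE; have -> : inner (B y) (B y) = inner y (B (B y)) by rewrite adjE Ba.
rewrite -[B (B y)]/((B * B) y) B_sq !opE addrC.
by rewrite innerDr.
Qed.

Lemma block_add1_invertible : exists D, D * (B + 1) = 1 /\ (B + 1) * D = 1.
Proof.
(* As B = S^* S and B C = 1, W^* W = (1 - C) C B C (1 - C) / 4 is the polynomial C (1 - C)^2 / 4. *)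
pose W := 2^-1%:C *: (S * (C * (1 - C))).
have WW : W^*o * W = 4^-1%:C *: (C * ((1 - C) * (1 - C))).
  rewrite /W adjopZ conjC_real !adjopM adjopB adjop1 Ca.
  rewrite scaleop_mulr scaleop_mull scalerA -rmorphM /=.
  have -> : 2^-1 * 2^-1 = 4^-1 :> R by field.
  congr (_ *: _); rewrite -!mulrA [S^*o * _]mulrA -B_pos [B * _]mulrA BC mul1r.
  by rewrite !mulrA; congr (_ * _); rewrite mulrBl mulrBr mul1r mulr1.
have liftM T T' : lift T * lift T' = lift (T * T').
  by apply: adjopP => x; rewrite /lift !opE U1K.
have [||| Z [ZC CZ]] := @add1_invertible _ _ H (lift C) (lift W).
- by rewrite /lift !adj_comp adjopK Ca; apply: adjopP => x.
- by move=> x; rewrite mul1r; exact: block_lift_contraction.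
- have -> : (lift W)^*o = lift W^*o.
    by rewrite /lift !adj_comp adjopK; apply: adjopP => x.
  rewrite liftM WW; apply: adjopP => x; rewrite /lift !opE !adjop_mapE.
  by rewrite !U1K.
(* Compressing the inverse of 1 + [lift C] to X inverts 1 + C; then B + 1 = B (1 + C) is invertible
   too. *)
pose D := U1 \c (Z \c U1^*o).
have C1D : (1 + C) * D = 1.
  apply: adjopP => y; rewrite /D !opE -[y in RHS]U1K.
  rewrite -[in RHS](oneopE (U1^*o y)) -CZ /lift !opE adjop_mapD U1K.
  by [].
have DC1 : D * (1 + C) = 1.
  apply: adjopP => y; rewrite /D !opE -[y in RHS]U1K.
  rewrite -[in RHS](oneopE (U1^*o y)) -ZC /lift !opE U1K adjop_mapD.
  by [].
have B1 : B + 1 = B * (1 + C) by rewrite mulrDr mulr1 BC.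
have B1' : B + 1 = (1 + C) * B by rewrite mulrDl mul1r CB.
exists (D * C); split.
  by rewrite B1 -mulrA [C * _]mulrA CB mul1r.
have CD : C * D = D * C.
  have CC1 : C * (1 + C) = (1 + C) * C by rewrite mulrDr mulrDl mulr1 mul1r.
  by rewrite -[LHS]mul1r -DC1 -mulrA [_ * (C * D)]mulrA -CC1 -mulrA C1D mulr1.
by rewrite -CD B1' -mulrA [B * _]mulrA BC mul1r.
Qed.
Lemma block_projection E : E * (B * (B + 1)) = 1 -> B * (B + 1) * E = 1 ->
  is_projection (2^-1%R *: (U1^*o \c ((B + 1) * C \c U1 + C \c A0 \c U2)
    + U2^*o \c (A0^*o \c C \c U1 + A0^*o \c E \c A0 \c U2))).
Proof.
move=> EB BE.
have Ea : E^*o = E.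
  apply: selfadjoint_inverse EB BE.
  by rewrite adjopM adjopD adjop1 Ba mulrDl mulrDr mul1r mulr1.
(* This is 1 / (B + 1) + 1 / (B (B + 1)) = 1 / B. *)
have BE_E : B * E + E = C.
  by rewrite -[RHS]mulr1 -BE !mulrA CB mul1r mulrDl mul1r.
have EB_E : E * B + E = C.
  have comm : B * (B + 1) = (B + 1) * B by rewrite mulrDr mulrDl mulr1 mul1r.
  by rewrite -[RHS]mul1r -EB comm -!mulrA BC mulr1 mulrDr mulr1.
have AAs z : A0 (A0^*o z) = B (B z) - z.
  by rewrite -[B (B z)]/((B * B) z) B_sq !opE addrK.
have BCv z : B (C z) = z by rewrite -[LHS]/((B * C) z) BC.
have CBv z : C (B z) = z by rewrite -[LHS]/((C * B) z) CB.
have BEv z : B (E z) = C z - E z by rewrite -BE_E !opE addrK.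
have EBv z : E (B z) = C z - E z by rewrite -EB_E !opE addrK.
have CCv z : C (C z) = E z + E (C z).
  by have := congr1 (fun T : adjop X X => T (C z)) EB_E; rewrite !opE BCv.
set M := U1^*o \c _ + U2^*o \c _.
have ME x : M x = U1^*o (U1 x + C (U1 x) + C (A0 (U2 x))) +
    U2^*o (A0^*o (C (U1 x) + E (A0 (U2 x)))).
  by rewrite /M !opE BCv [A0^*o (_ + _)]adjop_mapD.
(* M x is determined by u = U1 x and w = A0 (U2 x). As A0 A0^* = B^2 - 1, the same data for M x are
   expressed by B, C and E alone. *)
have MM : M * M = M + M.
  apply: adjopP => x; rewrite mulopE addopE (ME (M x)).
  have -> : U1 (M x) = U1 x + C (U1 x) + C (A0 (U2 x)).
    by rewrite ME adjop_mapD U1K U12 addr0.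
  have -> : U2 (M x) = A0^*o (C (U1 x) + E (A0 (U2 x))).
    by rewrite ME adjop_mapD U2K U21 add0r.
  rewrite AAs (ME x); move: (U1 x) (A0 (U2 x)) => u w.
  have -> : B (B (C u + E w)) - (C u + E w) = B u - C u + w - C w.
    by rewrite !(adjop_mapD, adjop_mapN, BCv, BEv); module.
  rewrite addrACA -!adjop_mapD; congr (U1^*o _ + U2^*o (A0^*o _)).
    by rewrite !(adjop_mapD, adjop_mapN, CBv); module.
  by rewrite !(adjop_mapD, adjop_mapN, EBv) !CCv; module.
have Ma : M^*o = M.
  rewrite /M !(adjopD, adj_comp, adjopM, adjopK) adjop1 Ba Ca Ea.
  apply: adjopP => x; rewrite !opE !(adjop_mapD, BCv, CBv).
  by rewrite addrACA.
split.
  rewrite /is_idempotent scaleop_mulr scaleop_mull MM scalerA.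
  have -> : M + M = 2 *: M by module.
  by rewrite scalerA -mulrA mulVf ?mulr1// pnatr_eq0.
by rewrite adjopZ Ma fmorphV rmorph_nat.
Qed.
End BlockProjection.

(** * Matched projections are projections *)

Section MatchedIsProjection.
Context (R : realType) (A : cstarAlgType R) (H : hilbertModType A).
Implicit Types (P Q T : adjop H H).

(** T^* restricted to M is an adjoint of the corestriction, so [xget] does not fall back on its
    default. *)
Lemma corestrictE (M : submodule H) T : (forall x, T x \in submod_pred M) ->
  forall x, val (corestrict M T x) = T x.
Proof.
move=> TM; pose g x : submod_type M := SubmodElt (TM x).
have gadj : g \in @adjointable R A H (submod_type M).
  apply/asboolP; exists (fun y => T^*o (val y)) => x y.
  by rewrite -adjE.
have ex : exists T' : adjop H (submod_type M), forall x, val (T' x) = T x.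
  by exists (AdjOp gadj).
exact: (@xgetPex _ 0
  [set T' : adjop H (submod_type M) | forall x, val (T' x) = T x]%classic ex).
Qed.

Lemma corestrict_adjE (M : submodule H) T : (forall x, T x \in submod_pred M) ->
  forall y, (corestrict M T)^*o y = T^*o (val y).
Proof.
move=> TM y; apply: inner_right_inj => x.
by rewrite -!adjE -[T x](corestrictE TM).
Qed.

(** The two equations give P and Q the same range, so the choice in [range_proj] succeeds; equality
    of ranges then returns the same equations for the chosen projection. *)
Lemma range_projP Q P : is_projection P -> P * Q = Q -> Q * P = P ->
  [/\ is_projection (range_proj Q), range_proj Q * Q = Q &
      Q * range_proj Q = range_proj Q].
Proof.
move=> Pp PQ QP; have QQ : Q * Q = Q by rewrite -{2}PQ mulrA QP.
have PQr : op_range P =i op_range Q.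
  move=> y; apply/asboolP/asboolP => -[x <-].
    by exists (P x); rewrite -mulopE QP.
  by exists (Q x); rewrite -mulopE PQ.
have [] : is_projection (range_proj Q) /\ op_range (range_proj Q) =i op_range Q.
  exact: (@xgetPex _ 0
    [set P | is_projection P /\ op_range P =i op_range Q]%classic
    (ex_intro _ P (conj Pp PQr))).
move: (range_proj Q) => P' P'p P'r; split => //; apply: adjopP => x.
  have : Q x \in op_range P' by rewrite P'r; apply/asboolP; exists x.
  by move=> /asboolP[z zE]; rewrite mulopE -zE -mulopE P'p.1.
have : P' x \in op_range Q by rewrite -P'r; apply/asboolP; exists x.
by move=> /asboolP[z zE]; rewrite mulopE -zE -mulopE QQ.
Qed.

(** If no root existed, the default 0 would be left invertible, so 1 = 0 on X and 0 would itself be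
    a positive root of T. *)
Lemma op_sqrtP (X : innerModType A) (T C : adjop X X) :
  C * op_sqrt T = 1 -> op_pos (op_sqrt T) /\ op_sqrt T * op_sqrt T = T.
Proof.
move=> CT.
have [ex|nex] := pselect (exists B, op_pos B /\ B * B = T).
  exact: (@xgetPex _ 0 [set B | op_pos B /\ B * B = T]%classic ex).
have B0 : op_sqrt T = 0.
  by apply: xgetPN => B TB; apply: nex; exists B.
move: CT; rewrite B0 mulr0 => /esym z1.
exfalso; apply: nex; exists 0.
by split; [exists 0|rewrite -[RHS]mulr1 z1]; rewrite !mulr0.
Qed.

Lemma matched_projection Q P : is_projection P -> P * Q = Q -> Q * P = P ->
  is_projection (matched Q).
Proof.
move=> Pp PQ QP; rewrite /matched; case: asboolP => // _.
have [[P'P' P'a] P'Q QP'] := range_projP Pp PQ QP.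
set B := matched_B Q; set P' := range_proj Q in P'P' P'a P'Q QP' *.
have Qa : Q^*o * P' = Q^*o by rewrite -{1}P'a -adjopM P'Q.
have P'Qa : P' * Q^*o = P' by rewrite -{1}P'a -adjopM QP'.
have U1in x : P' x \in op_range Q.
  by apply/asboolP; exists (P' x); rewrite -mulopE QP'.
have U2in x : (1 - P' : adjop H H) x \in op_null Q^*o.
  by apply/asboolP; rewrite -mulopE mulrBr mulr1 Qa subrr.
have [[C [CB BC]]|nB] := pselect (exists C, C * B = 1 /\ B * C = 1); last first.
  (* An inverse of B (B + 1) would invert B, as the two factors commute. Hence both inverses take
     the default 0, and so does the block matrix. *)
  have nBB : ~ exists E, E * (B * (B + 1)) = 1 /\ B * (B + 1) * E = 1.
    move=> [E [EB BE]]; apply: nB.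
    have comm : (B + 1) * B = B * (B + 1) by rewrite mulrDl mulrDr mul1r mulr1.
    have EB' : E * (B + 1) * B = 1 by rewrite -mulrA comm.
    have BE' : B * ((B + 1) * E) = 1 by rewrite mulrA.
    exists (E * (B + 1)); split=> //.
    suff -> : E * (B + 1) = (B + 1) * E by [].
    by rewrite -[LHS]mulr1 -[X in _ * X = _]BE' mulrA EB' mul1r.
  rewrite (op_inv_out nB) (op_inv_out nBB) mulr0.
  set Z := _ *: _; have -> : Z = 0.
    apply: adjopP => x; rewrite /Z /block_conj !opE.
    by rewrite !(adjop_map0, addr0, scaler0).
  by split; [rewrite /is_idempotent mulr0|rewrite adjop0].
have [B_pos B_sq] := op_sqrtP CB.
(* The adjoints of [matched_U1] and [matched_U2] are the inclusions of the two submodules. *)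
have U1K : cancel (matched_U1 Q)^*o (matched_U1 Q).
  move=> y; apply: val_inj; rewrite (corestrictE U1in) (corestrict_adjE U1in).
  rewrite P'a; have /asboolP[z <-] := valP y.
  by rewrite -!mulopE P'P' P'Q.
have P'null y : y \in op_null Q^*o -> P' y = 0.
  by move=> /asboolP y0; rewrite -P'Qa mulopE y0 adjop_map0.
have U2K : cancel (matched_U2 Q)^*o (matched_U2 Q).
  move=> y; apply: val_inj; rewrite (corestrictE U2in) (corestrict_adjE U2in).
  have y0 := P'null _ (valP y).
  by rewrite adjopB adjop1 P'a !opE y0 !subr0 y0 subr0.
have U12 y : matched_U1 Q ((matched_U2 Q)^*o y) = 0.
  apply: val_inj; rewrite (corestrictE U1in) (corestrict_adjE U2in).
  have y0 := P'null _ (valP y).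
  by rewrite adjopB adjop1 P'a !opE y0 subr0 y0.
have [S BS] := B_pos.
have [D [DB BD]] := block_add1_invertible U1K U2K U12 BS B_sq CB BC.
have EB : D * C * (B * (B + 1)) = 1.
  by rewrite -mulrA [C * _]mulrA CB mul1r.
have BE : B * (B + 1) * (D * C) = 1.
  by rewrite -mulrA [(B + 1) * _]mulrA BD mul1r.
rewrite (op_invP CB BC) (op_invP EB BE).
exact: block_projection U1K U2K U12 BS B_sq CB BC _ EB BE.
Qed.
End MatchedIsProjection.

(** * Idempotents attached to a pair of projections *)

Section TwoProjections.
Context (R : realType) (A : cstarAlgType R) (H : hilbertModType A).
Implicit Types (P Q L F T : adjop H H).

(** L = 1 + P P' L shows that L P takes its values in the range of P, and P (1 - P') P = (1 - P P')
    P lets L cancel in Q P. *)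
Lemma oblique_projection P P' L :
  is_projection P -> is_projection P' ->
  L * (1 - P * P') = 1 -> (1 - P * P') * L = 1 ->
  let Q := L * P * (1 - P') in [/\ P * Q = Q, Q * P = P & Q * P' = 0].
Proof.
move=> [PP _] [PP' _] LP PL Q; split.
- have L1 : L = 1 + P * P' * L by rewrite -[X in X + _]PL mulrBl mul1r subrK.
  have PLP : P * (L * P) = L * P.
    rewrite L1 mulrDl mul1r mulrDr PP; congr (_ + _).
    by rewrite !mulrA PP.
  by rewrite /Q !mulrA -[P * L * P]mulrA PLP.
- rewrite /Q -!mulrA mulrBl mul1r mulrBr PP.
  have -> : P - P * (P' * P) = (1 - P * P') * P by rewrite mulrBl mul1r mulrA.
  by rewrite mulrA LP mul1r.
- by rewrite /Q -!mulrA mulrBl mul1r PP' subrr !mulr0.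
Qed.

(** From L x = x + T (L x), the norm of L x times 1 - [opnorm T] is at most the norm of x. *)
Lemma bounded_inverse_sub1 T L : bounded T -> opnorm T < 1 ->
  (1 - T) * L = 1 -> bounded L.
Proof.
move=> bT T1 TL; have t0 : 0 < 1 - opnorm T by rewrite subr_gt0.
exists (1 - opnorm T)^-1; first by rewrite invr_ge0 ltW.
move=> x; rewrite mulrC ler_pdivlMr//.
have xE : L x = x + T (L x).
  by rewrite -[X in X + _](oneopE x) -TL !opE subrK.
have := rnormD x (T (L x)); rewrite -xE.
have := bounded_by_opnorm bT (L x); lra.
Qed.

Lemma bounded_projection P : is_projection P -> bounded P.
Proof. by move=> /projection_bounded P1; exists 1. Qed.

(** E x = F^2 (E x), so F strictly shrinks norms on the range of E unless that range is 0. *)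
Lemma idempotent_opnorm_lt1 F E : bounded F -> opnorm F < 1 ->
  F * F = E -> E * E = E -> E = 0.
Proof.
move=> bF F1 FF EE; apply: adjopP => x; apply: rnorm0_eq0; apply/eqP.
rewrite eq_le rnorm_ge0 andbT.
have F0 := opnorm_ge0 bF; have bFF := bounded_by_opnorm bF.
have := bounded_byM F0 bFF bFF (E x); rewrite FF -mulopE EE.
have r0 := rnorm_ge0 (E x).
have : 0 <= opnorm F * (rnorm (E x) * (1 - opnorm F)).
  by rewrite !mulr_ge0// subr_ge0 ltW.
nra.
Qed.

End TwoProjections.

Theorem theorem4p8 (R : realType) (A : cstarAlgType R) (H : hilbertModType A)
    (P1 P2 : adjop H H) (hP1 : is_projection P1) (hP2 : is_projection P2)
    (hP12 : opnorm (P1 * P2) < 1) :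
  let Q1 := op_inv (1 - P1 * P2) * P1 * (1 - P2) in
  let Q2 := op_inv (1 - P2 * P1) * P2 * (1 - P1) in
  opnorm (matched Q1 - matched Q2) <= opnorm (Q1 - Q2).
Proof.
set Q1 := _ * _ * _; set Q2 := op_inv (1 - P2 * P1) * _ * _; cbv zeta.
set D := matched Q1 - matched Q2; set F := Q1 - Q2.
have adj12 : (1 - P1 * P2)^*o = 1 - P2 * P1.
  by rewrite adjopB adjop1 adjopM hP1.2 hP2.2.
have [[L [L1 L2]]|nL] :=
    pselect (exists L, L * (1 - P1 * P2) = 1 /\ (1 - P1 * P2) * L = 1);
    last first.
  (* Invertibility passes to adjoints, so in this branch both inverses are the default 0, Q1 = Q2 =
     0, and both sides are [opnorm 0]. *)
  have nL' : ~ exists L, L * (1 - P2 * P1) = 1 /\ (1 - P2 * P1) * L = 1.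
    move=> [L [L1 L2]]; apply: nL; exists L^*o.
    by rewrite -[1 - P1 * P2]adjopK adj12 -!adjopM L1 L2 adjop1.
  rewrite /D /F /Q1 /Q2 (op_inv_out nL) (op_inv_out nL') !mul0r.
  by rewrite !subrr.
have La1 : L^*o * (1 - P2 * P1) = 1 by rewrite -adj12 -adjopM L2 adjop1.
have La2 : (1 - P2 * P1) * L^*o = 1 by rewrite -adj12 -adjopM L1 adjop1.
have Q1E : Q1 = L * P1 * (1 - P2) by rewrite /Q1 (op_invP L1 L2).
have Q2E : Q2 = L^*o * P2 * (1 - P1) by rewrite /Q2 (op_invP La1 La2).
have := oblique_projection hP1 hP2 L1 L2; rewrite /= -Q1E => -[PQ1 QP1 Q1P2].
have := oblique_projection hP2 hP1 La1 La2; rewrite /= -Q2E => -[PQ2 QP2 Q2P1].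
have Q11 : Q1 * Q1 = Q1 by rewrite -{2}PQ1 mulrA QP1.
have Q22 : Q2 * Q2 = Q2 by rewrite -{2}PQ2 mulrA QP2.
have Q12 : Q1 * Q2 = 0 by rewrite -PQ2 mulrA Q1P2 mul0r.
have Q21 : Q2 * Q1 = 0 by rewrite -PQ1 mulrA Q2P1 mul0r.
(* The hypothesis on [opnorm (P1 * P2)] enters here: it bounds L, hence F, so that [opnorm F] is an
   actual bound for F. *)
have bL : bounded L.
  apply: bounded_inverse_sub1 hP12 L2.
  by apply: boundedM; exact: bounded_projection.
have b1 : bounded (1 : adjop H H) by exists 1 => //; exact: bounded_by1.
have bF : bounded F.
  have [bP1 bP2] := (bounded_projection hP1, bounded_projection hP2).
  rewrite /F Q1E Q2E; apply: boundedB; apply: boundedM; try exact: boundedB.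
    exact: boundedM.
  by apply: boundedM => //; exact: bounded_adj.
have [F1|F1] := leP 1 (opnorm F).
  rewrite (le_trans _ F1)// opnorm_le//.
  apply: projectionB_bounded; first exact: matched_projection PQ1 QP1.
  exact: matched_projection PQ2 QP2.
have FF : F * F = Q1 + Q2.
  by rewrite /F mulrBr !mulrBl Q11 Q12 Q21 Q22 subr0 sub0r opprK.
have QQ0 : Q1 + Q2 = 0.
  apply: idempotent_opnorm_lt1 bF F1 FF _.
  by rewrite mulrDr !mulrDl Q11 Q12 Q21 Q22 add0r addr0.
have Q10 : Q1 = 0.
  by rewrite -Q11 -[LHS]addr0 -[X in _ + X]Q12 -mulrDr QQ0 mulr0.
have Q20 : Q2 = 0 by move: QQ0; rewrite Q10 add0r.
by rewrite /D /F Q10 Q20 !subrr.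
Qed.
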